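(* For every integer $n\ge 1$, the permutation $\rho_n$ (defined in the context) of length $n^2$ is a proper $n$-universal permutation for the set $S_n(321)$; that is, $\rho_n$ itself avoids the pattern $321$, and every $321$-avoiding permutation of length $n$ is contained in $\rho_n$ as a pattern.
   Context: A permutation of $[m]=\{1,\dots,m\}$ is written in one-line notation $\pi(1)\pi(2)\cdots\pi(m)$. A permutation $\pi$ contains a permutation $\sigma$ as a pattern if $\pi$ has a subsequence order-isomorphic to $\sigma$; otherwise $\pi$ avoids $\sigma$. $S_n(321)$ denotes the set of permutations of length $n$ avoiding $321$ (no decreasing subsequence of length $3$). For a set $X$ of permutations, a permutation $\Pi$ is $n$-universal for $X$ if it contains every permutation of length $n$ from $X$ as a pattern; it is proper if moreover $\Pi$ belongs to the class of $321$-avoiding permutations (here: $\Pi$ avoids $321$). Definition of $\rho_n$: $\rho_1=1$ and $\rho_2=3142$. For $n\ge 3$, let $k=\lfloor n/2\rfloor$ if $n$ is odd and $k=n/2-1$ if $n$ is even. For $i=1,\dots,k$ define the block $B_i=a^{(i)}_1b^{(i)}_1a^{(i)}_2b^{(i)}_2\cdots a^{(i)}_nb^{(i)}_n$ where for $i=1$: $a^{(1)}_j=n+2j$, $b^{(1)}_j=j$, and for $i\ge 2$: $a^{(i)}_j=2ni-n+2j$, $b^{(i)}_j=2ni-3n+2j-1$ ($j=1,\dots,n$). If $n$ is odd, the final word is $F=f_1f_2\cdots f_n$ with $f_j=n^2-2n+2j-1$; if $n$ is even, the final word is $F=a_1b_1\cdots a_nb_n$ with $a_j=n^2-n+j$,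 $b_j=n^2-3n+2j-1$. Then $\rho_n=B_1B_2\cdots B_kF$ (concatenation of words), a permutation of $[n^2]$. For example $\rho_3=517293468$ and $\rho_4=6\,1\,8\,2\,10\,3\,12\,4\,13\,5\,14\,7\,15\,9\,16\,11$. *)

(* Defs.v *)
From mathcomp Require Import all_boot.

Set Implicit Arguments.
Unset Strict Implicit.
Unset Printing Implicit Defensive.

(* A permutation of [m] = {1, ..., m} is given by its one-line notation, a word
   over nat whose letters are 1, ..., m, each occurring once. *)
Definition is_perm_word (m : nat) (w : seq nat) : bool := perm_eq w (iota 1 m).

Definition order_iso (u v : seq nat) : Prop :=
  size u = size v /\
  forall i j, i < size u -> j < size u ->
    (nth 0 u i < nth 0 u j) = (nth 0 v i < nth 0 v j).

Definition contains (w s : seq nat) : Prop :=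
  exists2 u, subseq u w & order_iso u s.

Definition avoids (w s : seq nat) : Prop := ~ contains w s.

Definition S_av (s : seq nat) (n : nat) (w : seq nat) : Prop :=
  is_perm_word n w /\ avoids w s.

Definition universal (n : nat) (X : seq nat -> Prop) (w : seq nat) : Prop :=
  is_perm_word (size w) w /\
  forall s, is_perm_word n s -> X s -> contains w s.

Definition proper_universal (s : seq nat) (n : nat) (w : seq nat) : Prop :=
  universal n (S_av s n) w /\ avoids w s.

(* The word a_1 b_1 a_2 b_2 ... a_n b_n. *)
Definition alternate (n : nat) (a b : nat -> nat) : seq nat :=
  flatten [seq [:: a j; b j] | j <- iota 1 n].

(* No subtraction below truncates in its range of use: 1 <= j <= n, with
   2 <= i in blk_a and blk_b, 3 <= n odd in the first branch of final_word and
   4 <= n even in the second. *)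
Definition blk_a (n i j : nat) : nat :=
  if i == 1 then n + 2 * j else 2 * n * i - n + 2 * j.

Definition blk_b (n i j : nat) : nat :=
  if i == 1 then j else 2 * n * i - 3 * n + 2 * j - 1.

Definition block (n i : nat) : seq nat := alternate n (blk_a n i) (blk_b n i).

Definition final_word (n : nat) : seq nat :=
  if odd n then [seq n ^ 2 - 2 * n + 2 * j - 1 | j <- iota 1 n]
  else alternate n (fun j => n ^ 2 - n + j)
                   (fun j => n ^ 2 - 3 * n + 2 * j - 1).

Definition nblocks (n : nat) : nat := if odd n then n %/ 2 else n %/ 2 - 1.

(* rho 0 is a junk value. *)
Definition rho (n : nat) : seq nat :=
  match n with
  | 0 => [::]
  | 1 => [:: 1]
  | 2 => [:: 3; 1; 4; 2]
  | _ => flatten [seq block n i | i <- iota 1 (nblocks n)] ++ final_word n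
  end.

Example rho3E : rho 3 = [:: 5; 1; 7; 2; 9; 3; 4; 6; 8].
Proof. by []. Qed.

Example rho4E :
  rho 4 = [:: 6; 1; 8; 2; 10; 3; 12; 4; 13; 5; 14; 7; 15; 9; 16; 11].
Proof. by []. Qed.

(* Main.v *)
(* Read from bottom left to top right, rho n is a staircase of n increasing
   cells of n entries each: b^(1), a^(1), b^(2), a^(2), and so on. Consecutive
   cells are interleaved alternately by position and by value, and entries of
   cells at distance at least 2 never form an inversion. Inversions go from an
   a-cell to a b-cell, so rho n avoids 321. Conversely, a 321-avoiding
   permutation is cut into cells greedily: alternately remove the longest run of
   smallest remaining values that is increasing, and the longest increasing
   prefix of what remains. No round is empty, so n cells suffice, and 321
   avoidance puts the two entries of an inversion into consecutive cells. The
   slots inside the cells are then read off a common ordering of all entries. *)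
Require Import Defs.
From mathcomp Require Import all_boot.
From mathcomp Require Import zify.

(** * Greedy cutting of a 321-avoiding permutation into cells *)

(* [p] and [v] are position and value, [c] is the cell of an entry and [f]
   orders the slots. The induction removes the first cell and exchanges the roles
   of [p] and [v]; the third clause (the whole first run is in cell 0) is what
   puts the partners of a removed entry into the next cell. *)
Lemma staircase (T : finType) (p v : T -> nat) (R : {set T}) :
  injective p -> injective v ->
  (forall x y z, p x < p y -> p y < p z -> v y < v x -> v z < v y -> False) ->
  exists c f : T -> nat,
  [/\ forall x, x \in R -> c x < #|R|,
      forall x, x \in R -> 0 < f x,
      forall x, x \in R ->
        (forall y z, y \in R -> z \in R -> v y < v z -> v z <= v x ->
           p y < p z) -> c x = 0,
      forall x y, x \in R -> y \in R -> p x < p y -> v x < v y ->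
        c x <= c y /\ (c y <= (c x).+1 -> f x < f y)
    & forall x y, x \in R -> y \in R -> p x < p y -> v y < v x ->
        [/\ odd (c x), ~~ odd (c y)
          & (c x = (c y).+1 /\ f x <= f y) \/ (c y = (c x).+1 /\ f y <= f x)]].
Proof.
have [m] := ubnP #|R|; elim: m p v R => // m IH p v R Rm pI vI av.
have [R0|[x0 x0R]] := set_0Vmem R.
  by exists (fun=> 0), (fun=> 0); rewrite R0; split=> x; rewrite inE.
pose init x := [forall y in R, forall z in R,
  (v y < v z <= v x) ==> (p y < p z)].
have initP x : reflect (forall y z, y \in R -> z \in R -> v y < v z ->
    v z <= v x -> p y < p z) (init x).
  apply: (iffP forall_inP) => [H y z yR zR yz zx | H y yR].
    by have /forall_inP/(_ z zR) := H y yR; rewrite yz zx.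
  by apply/forall_inP => z zR; apply/implyP => /andP[]; apply: H.
pose R' := [set x in R | ~~ init x].
have down x y : y \in R -> init y -> x \in R' -> v y < v x.
  rewrite inE => yR /initP iy /andP[xR nx]; rewrite ltnNge; apply/negP => xy.
  case/negP: nx; apply/initP => a b aR bR ab bx.
  exact: iy _ _ aR bR ab (leq_trans bx xy).
have R'R x : x \in R' -> x \in R by rewrite inE => /andP[].
have R'I x : x \in R -> init x = false -> x \in R' by rewrite inE => -> ->.
have ltR' : #|R'| < #|R|.
  (* The entry of smallest value always belongs to the first run, so each round removes
     something. *)
  have [y /= yR ymin] : exists2 y, y \in R & forall a, a \in R -> v y <= v a.
    by case: (arg_minnP v x0R) => y; exists y.
  apply/proper_card/properP; split; first by apply/subsetP => x /R'R.
  exists y => //; rewrite inE yR negbK; apply/initP => a b aR bR ab yb.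
  by have := ymin a aR; rewrite leqNgt (leq_trans ab yb).
have [|c [f [cR f0 c0 mon inv]]] := IH v p R' (leq_trans ltR' Rm) vI pI.
  (* The pattern 321 is its own inverse, so avoidance survives the exchange of [p] and [v]. *)
  by move=> x y z xy yz yx zy; apply: (av z y x).
(* Scaling by N makes room below each old slot: a removed entry x goes just above
   the slots of all remaining entries to its left, and v x orders ties. *)
pose N := (\max_x v x).+2.
have vN x : (v x).+1 < N by rewrite /N !ltnS leq_bigmax.
pose M x := \max_(y in R' | p y < p x) f y.
(* A descent [a], [b] of [R'] at positions up to [p x] would form a 321 with [y], so [x] lies in the
   first run of the exchanged problem. *)
have c0_inv x y : x \in R' -> y \in R -> init y -> p x < p y -> c x = 0.
  move=> xR' yR iy xy; apply: c0 => // a b aR bR ab bx.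
  have: v a != v b by apply: contraTneq ab => /vI ->; rewrite ltnn.
  rewrite neq_ltn => /orP[//|ba].
  by case: (av a b y) => //; [apply: leq_ltn_trans xy | apply: down].
exists (fun x => if init x then 0 else (c x).+1).
exists (fun x => if init x then N * M x + (v x).+1 else N * f x).
split.
- move=> x xR; case: ifPn => [_|/negbTE nx].
    by apply/card_gt0P; exists x0.
  by apply: leq_trans ltR'; rewrite ltnS; apply: cR; apply: R'I.
- move=> x xR; case: ifPn => [_|/negbTE nx]; first by rewrite addnS.
  by rewrite muln_gt0 f0 ?R'I.
- by move=> x xR /initP ->.
- move=> x y xR yR pxy vxy.
  case: ifPn => [ix|/negbTE ix]; case: ifPn => [iy|/negbTE iy].
  + split=> // _; rewrite -addnS leq_add // leq_mul //.
    apply/bigmax_leqP => z /andP[zR pz]; apply: leq_bigmax_cond.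
    by rewrite zR (ltn_trans pz).
  + split=> //; rewrite ltnS leqn0 => /eqP cy; have yR' := R'I y yR iy.
    (* Positivity of [f y] handles the empty maximum. Any [z] counted in [M x] is in cell 0, as is
       [y]; two entries of one cell are not inverted, so [f z < f y]. *)
    have Mf : M x < f y.
      rewrite -(prednK (f0 y yR')) ltnS; apply/bigmax_leqP => z /andP[zR' pz].
      rewrite -ltnS (prednK (f0 y yR')).
      have cz := c0_inv z x zR' xR ix pz.
      have pzy := ltn_trans pz pxy.
      have: v z != v y by apply: contraTneq pzy => /vI ->; rewrite ltnn.
      rewrite neq_ltn => /orP[vzy|vyz].
        by have [_] := mon z y zR' yR' vzy pzy; rewrite cy; apply.
      by have [] := inv y z yR' zR' vyz pzy; rewrite cy cz.
    apply: leq_trans (_ : N * (M x).+1 <= _); last by rewrite leq_mul.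
    by rewrite mulnS addnC ltn_add2r.
  + by have := down x y yR iy (R'I x xR ix); rewrite ltnNge (ltnW vxy).
  + have [c1 c2] := mon x y (R'I _ xR ix) (R'I _ yR iy) vxy pxy.
    split; first by rewrite ltnS.
    by rewrite ltnS => /c2; rewrite ltn_mul2l.
- move=> x y xR yR pxy vyx.
  case: ifPn => [ix|/negbTE ix]; case: ifPn => [iy|/negbTE iy].
  + by have /initP/(_ y x yR xR vyx (leqnn _)) := ix; rewrite ltnNge (ltnW pxy).
  + by have := down y x xR ix (R'I y yR iy); rewrite ltnNge (ltnW vyx).
  + have xR' := R'I x xR ix; rewrite (c0_inv x y) //; split=> //; left; split=> //.
    apply: leq_trans (leq_addr _ _); rewrite leq_mul //.
    by apply: leq_bigmax_cond; rewrite xR'.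
  + have [o1 o2 H] := inv y x (R'I _ yR iy) (R'I _ xR ix) vyx pxy.
    split; [by [] | by rewrite negbK |].
    by case: H => -[-> H]; [right|left]; split=> //; rewrite leq_mul.
Qed.

(** * Coordinates of the slots of the staircase *)

(* Cells and slots are numbered from 0: cell 2q is b^(q+1) and cell 2q+1 is
   a^(q+1). Unpaired cells take consecutive positions (the last cell, if n is odd)
   or values (cell 0, and the last cell if n is even). *)
Definition pos (n c j : nat) : nat :=
  2 * n * c./2 + if (c == n.-1) && ~~ odd c then j else 2 * j + ~~ odd c.

(* The subtraction truncates to 0 at c = 0, as intended. *)
Definition letter (n c j : nat) : nat :=
  (2 * n * uphalf c - n) +
    (if (c == 0) || ((c == n.-1) && odd c) then j else 2 * j + odd c) + 1.

Lemma leq_mul_step (d g g' : nat) : g < g' -> d * g + d <= d * g'.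
Proof. by move=> gg; rewrite -mulnSr leq_mul2l gg orbT. Qed.

Section Coordinates.
Variables (n c c' j j' : nat).
Hypotheses (cn : c < n) (cn' : c' < n) (jn : j < n) (jn' : j' < n).

(** Cells [2q] and [2q+1] lie in the window of [2 * n] positions starting at [2 * n * q]. *)
Lemma pos_lt_block : c./2 < c'./2 -> pos n c j < pos n c' j'.
Proof.
move/(leq_mul_step (2 * n)); rewrite /pos.
by move: (2 * n * c./2) (2 * n * c'./2) => A A'; case: ifP; case: ifP; lia.
Qed.

(** Cells [2g-1] and [2g] lie in the band of [2 * n] values just above [2 * n * g - n]; cell 0 is a
    band by itself, where the subtraction truncates. *)
Lemma letter_lt_band : uphalf c < uphalf c' -> letter n c j < letter n c' j'.
Proof.
move=> gg; have := leq_mul_step (2 * n) _ _ gg; rewrite /letter.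
have [c0|c0] := posnP c.
  by rewrite c0 /= muln0; move: (2 * n * uphalf c') => A'; case: ifP; lia.
have : 2 * n <= 2 * n * uphalf c by rewrite leq_pmulr; lia.
by move: (2 * n * uphalf c) (2 * n * uphalf c') => A A'; case: ifP; case: ifP; lia.
Qed.

(** Cells sharing a block are equal or consecutive, so there the slots decide. The hypotheses mirror
    the non-inverted case of [staircase]. *)
Lemma pos_lt_sw : c <= c' -> (c' <= c.+1 -> j < j') -> pos n c j < pos n c' j'.
Proof.
move=> cc jj; have [/pos_lt_block//|] := ltnP c./2 c'./2.
move=> e; have {}e : c'./2 = c./2 by lia.
by rewrite /pos e; move: (2 * n * c./2) => A; case: ifP; case: ifP; lia.
Qed.

Lemma letter_lt_sw :
  c <= c' -> (c' <= c.+1 -> j < j') -> letter n c j < letter n c' j'.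
Proof.
move=> cc jj; have [/letter_lt_band//|] := ltnP (uphalf c) (uphalf c').
move=> e; have {}e : uphalf c' = uphalf c by lia.
by rewrite /letter e; move: (2 * n * uphalf c) => A; case: ifP; case: ifP; lia.
Qed.

(** In a common block the odd cell takes offset [2 * j] and the even cell [2 * j + 1], so a weak
    inequality of slots suffices. For values the parities are exchanged. *)
Lemma pos_lt_inv : odd c -> ~~ odd c' ->
  (c = c'.+1 /\ j <= j') \/ c < c' -> pos n c j < pos n c' j'.
Proof.
move=> oc oc' [[cc jj]|cc]; last by apply: pos_lt_block; lia.
have e : c'./2 = c./2 by lia.
by rewrite /pos e; move: (2 * n * c./2) => A; case: ifP; case: ifP; lia.
Qed.

Lemma letter_lt_inv : ~~ odd c -> odd c' ->
  (c = c'.+1 /\ j <= j') \/ c < c' -> letter n c j < letter n c' j'.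
Proof.
move=> oc oc' [[cc jj]|cc]; last by apply: letter_lt_band; lia.
have e : uphalf c' = uphalf c by lia.
by rewrite /letter e; move: (2 * n * uphalf c) => A; case: ifP; case: ifP; lia.
Qed.

End Coordinates.

Lemma pos_lt_size n c j : c < n -> j < n -> pos n c j < n ^ 2.
Proof.
move=> cn jn; rewrite /pos expnS expn1 (mulnC 2) -mulnA.
have [/andP[/eqP e oc]|special] := ifP.
  have -> : 2 * c./2 = c by lia.
  have -> : n * n = n * c + n by rewrite -mulnSr; congr (_ * _); lia.
  by rewrite ltn_add2l.
apply: (@leq_trans (n * (2 * c./2) + n * 2)); first lia.
by rewrite -mulnDr leq_mul2l; lia.
Qed.

Lemma letter_surj n v : 0 < v <= n ^ 2 ->
  exists c j, [/\ c < n, j < n & letter n c j = v].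
Proof.
case: v => // v /=; rewrite expnS expn1 => vn.
have n0 : 0 < n by case: (n) vn.
have [v1|v1] := ltnP v n; first by exists 0, v; split; rewrite /letter //=; lia.
(* Here [v] is already lowered by 1. Past the [n] values of cell 0, [g.+1] is the band and [r] the
   offset in it. *)
pose w := v - n; pose g := w %/ (2 * n); pose r := w %% (2 * n).
have wE : w = n * (2 * g) + r.
  by rewrite mulnCA mulnA mulnC; apply: divn_eq.
have rn : r < 2 * n by rewrite ltn_mod; lia.
have wn : w < n * n.-1.
  by rewrite -subn1 mulnBr muln1 /w; apply: ltn_sub2r => //; apply: leq_trans vn.
have gn : 2 * g < n.-1.
  rewrite -(ltn_pmul2l n0); apply: leq_ltn_trans wn; rewrite wE.
  by rewrite leq_addr.
have letterE c j : uphalf c = g.+1 -> letter n c j =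
    v - r + (if (c == 0) || ((c == n.-1) && odd c) then j else 2 * j + odd c) + 1.
  move=> cg; rewrite /letter cg; congr (_ + _ + _).
  have -> : 2 * n * g.+1 = n * (2 * g) + 2 * n by rewrite mulnSr mulnAC mulnC.
  by move: wE; rewrite /w; move: (n * (2 * g)); lia.
have rv : r <= v by move: wE; rewrite /w; move: (n * (2 * g)); lia.
(* If [n] is even, the top band holds only the last cell; elsewhere the parity of [r] selects the
   cell. *)
have [gE|gE] := eqVneq (2 * g).+1 n.-1.
  exists (2 * g).+1, r; split; first lia.
    by rewrite -(ltn_add2l (n * (2 * g))) -wE -mulnSr gE.
  by rewrite letterE; [case: ifP; lia | lia].
exists ((2 * g).+1 + ~~ odd r), r./2; split; [lia | lia |].
by rewrite letterE; [case: ifP; lia | lia].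
Qed.

(** * Entries of [rho n] in slot coordinates *)

Lemma nth_flatten_uniform (T : Type) (x0 : T) (F : nat -> seq T) m s k q r :
  (forall i, size (F i) = m) -> q < k -> r < m ->
  nth x0 (flatten [seq F i | i <- iota s k]) (m * q + r) = nth x0 (F (s + q)) r.
Proof.
move=> Fm; elim: k s q => // k IH s [|q] qk rm /=; rewrite nth_cat Fm.
  by rewrite muln0 addn0 rm.
rewrite ifN; last by rewrite -leqNgt mulnS; lia.
by rewrite (_ : _ - m = m * q + r) ?IH ?addnS //; rewrite mulnS; lia.
Qed.

Lemma size_flatten_uniform (T : Type) (F : nat -> seq T) m s k :
  (forall i, size (F i) = m) -> size (flatten [seq F i | i <- iota s k]) = m * k.
Proof.
by move=> Fm; elim: k s => [|k IH] s /=; rewrite ?muln0 // size_cat Fm IH mulnS.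
Qed.

Lemma size_alternate n a b : size (alternate n a b) = 2 * n.
Proof. exact: size_flatten_uniform. Qed.

Lemma nth_alternate n a b j (o : bool) : j < n ->
  nth 0 (alternate n a b) (2 * j + o) = if o then b j.+1 else a j.+1.
Proof.
by move=> jn; rewrite nth_flatten_uniform //; case: o.
Qed.

Lemma size_rho n : 0 < n -> size (rho n) = n ^ 2.
Proof.
case: n => [|[|[|n]]] // _; rewrite /rho; set m := n.+3.
rewrite size_cat (size_flatten_uniform _ _ (2 * m)); last first.
  by move=> i; apply: size_alternate.
rewrite /final_word /nblocks; case: ifP => om.
  rewrite size_map size_iota; have : m = 2 * (m %/ 2) + 1 by lia.
  nia.
rewrite size_alternate; have : m = 2 * (m %/ 2 - 1) + 2 by lia.
nia.
Qed.

Lemma nth_rho n c j : c < n -> j < n -> nth 0 (rho n) (pos n c j) = letter n c j.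
Proof.
case: n => [|[|[|n]]] //.
- by case: c j => [|c] [|j].
- by case: c => [|[|c]] //; case: j => [|[|j]].
rewrite {1}/rho; set m := n.+3 => cm jm.
have sz : size (flatten [seq block m i | i <- iota 1 (nblocks m)]) =
  2 * m * nblocks m.
  by apply: size_flatten_uniform => i; apply: size_alternate.
have m2 : m ^ 2 = m * m by rewrite expnS expn1.
have hm : 2 < m by [].
move: sz; clearbody m => sz; rewrite nth_cat sz.
(* Cell [c] lies in block [c./2 + 1] or in the final word, which is cell [m.-1] for odd [m] and the
   last two cells for even [m]. *)
have [ck|ck] := ltnP c./2 (nblocks m).
  have [nl nl'] : (c == m.-1) && ~~ odd c = false /\ (c == m.-1) && odd c = false.
    by move: ck; rewrite /nblocks; case: ifP; lia.
  rewrite /pos nl ifT; last first.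
    apply: leq_trans (_ : 2 * m * c./2 + 2 * m <= _); first lia.
    exact: leq_mul_step.
  rewrite nth_flatten_uniform; [|by move=> i; apply: size_alternate|by []|lia].
  rewrite nth_alternate // /blk_a /blk_b /letter nl' orbF mulnDr muln1.
  have [q0|q0] := posnP c./2.
    have -> : c = odd c by lia.
    by case: (odd c); rewrite ?muln1 ?muln0 /=; lia.
  have -> : (1 + c./2 == 1) = false by lia.
  have -> : (c == 0) = false by lia.
  have : 2 * m <= 2 * m * c./2 by rewrite leq_pmulr.
  rewrite uphalf_half mulnDr; case: (odd c); rewrite ?muln1 ?muln0 /=;
    move: (2 * m * c./2) => D; lia.
have {ck} qE : nblocks m = c./2.
  by move: ck; rewrite /nblocks; case: ifP; lia.
rewrite qE /pos ifF; last by rewrite ltnNge leq_addr.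
rewrite addKn /final_word /letter m2; have [om|om] := boolP (odd m).
  have cE : c = m.-1 by move: qE; rewrite /nblocks om; lia.
  have oc : odd c = false by lia.
  rewrite oc cE eqxx /= (nth_map 0) ?size_iota // nth_iota // -cE ?andbF ?orbF.
  have -> : (c == 0) = false by lia.
  have -> : m * m = 2 * m * c./2 + m.
    by rewrite (mulnC 2) -mulnA -mulnSr; congr (_ * _); lia.
  rewrite uphalf_half oc add0n.
  have : 2 * m <= 2 * m * c./2 by rewrite leq_pmulr; lia.
  move: (2 * m * c./2) => D; lia.
have -> : (c == m.-1) && ~~ odd c = false.
  by move: qE; rewrite /nblocks (negbTE om); lia.
have -> : m * m = 2 * m * c./2 + 2 * m.
  rewrite (mulnC 2) -mulnA -mulnDr; congr (_ * _).
  by move: qE; rewrite /nblocks (negbTE om); lia.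
rewrite nth_alternate // uphalf_half mulnDr.
have : 2 * m <= 2 * m * c./2.
  by rewrite leq_pmulr; move: qE; rewrite /nblocks (negbTE om); lia.
have -> : (c == m.-1) = odd c.
  by move: qE; rewrite /nblocks (negbTE om); lia.
have -> : (c == 0) = false.
  by move: qE; rewrite /nblocks (negbTE om); lia.
by case: (odd c); rewrite ?muln1 ?muln0 /=; move: (2 * m * c./2) => D; lia.
Qed.

(** By counting: all [n ^ 2] values occur in a word of length [n ^ 2], so none repeats. *)
Lemma rho_is_perm n : 0 < n -> is_perm_word (n ^ 2) (rho n).
Proof.
move=> n0; rewrite /is_perm_word perm_sym.
have sub : {subset iota 1 (n ^ 2) <= rho n}.
  move=> x; rewrite mem_iota add1n ltnS => /letter_surj[c [j [cn jn <-]]].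
  by rewrite -nth_rho // mem_nth // size_rho // pos_lt_size.
have sz : size (rho n) <= size (iota 1 (n ^ 2)) by rewrite size_iota size_rho.
have un := leq_size_uniq (iota_uniq _ _) sub sz.
apply: uniq_perm (iota_uniq _ _) un _.
by have [] := uniq_min_size (iota_uniq _ _) sub sz.
Qed.

(** The letter at [t] has a slot by [letter_surj]; distinctness of letters puts that slot at [t]. *)
Lemma rho_pos_surj n t : t < n ^ 2 ->
  exists c j, [/\ c < n, j < n & pos n c j = t].
Proof.
move=> tn; have n0 : 0 < n by case: n tn.
have pe := rho_is_perm n n0.
have un : uniq (rho n) by rewrite (perm_uniq pe) iota_uniq.
have : nth 0 (rho n) t \in iota 1 (n ^ 2).
  by rewrite -(perm_mem pe) mem_nth // size_rho.
rewrite mem_iota add1n ltnS => /letter_surj[c [j [cn jn]]] E.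
exists c, j; split=> //; move: E; rewrite -nth_rho // => /eqP.
by rewrite nth_uniq ?size_rho ?pos_lt_size // => /eqP.
Qed.

(** * Inversions of [rho n] *)

(* Hence no entry can be the middle of a 321. *)
Lemma inversion_parity n c c' j j' : c < n -> c' < n -> j < n -> j' < n ->
  pos n c j < pos n c' j' -> letter n c' j' < letter n c j ->
  odd c && ~~ odd c'.
Proof.
move=> cn cn' jn jn' lt_pos lt_letter; apply/negPn/negP => opar.
have sw : ~ (c <= c' /\ (c' <= c.+1 -> j < j')).
  by case=> H1 H2; have := letter_lt_sw n c c' j j' cn cn' jn jn' H1 H2; lia.
have ne : ~ (c' <= c /\ (c <= c'.+1 -> j' < j)).
  by case=> H1 H2; have := pos_lt_sw n c' c j' j cn' cn jn' jn H1 H2; lia.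
have [eq_jc|ne_jc] := eqVneq (c, j) (c', j').
  by case: eq_jc lt_pos => -> ->; rewrite ltnn.
have {}ne_jc : c <> c' \/ j <> j'.
  by have [E|/eqP] := eqVneq c c'; [right=> E'; rewrite E E' eqxx in ne_jc | left].
(* Cells of equal parity coincide or are at least 2 apart, so [sw] and [ne] already conflict. *)
have [par|par] := eqVneq (odd c) (odd c'); first lia.
have oc : ~~ odd c by lia.
have oc' : odd c' by lia.
have [cc|cc] := ltnP c c'.
  have := letter_lt_inv n c c' j j' cn cn' jn jn' oc oc' (or_intror cc); lia.
have cc' : c' < c by lia.
have := pos_lt_inv n c' c j' j cn' cn jn' jn oc' oc (or_intror cc'); lia.
Qed.

(** * Pattern containment through increasing position maps *)

Lemma subseq_nth (T : eqType) (x0 : T) (w : seq T) (ts : seq nat) :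
  sorted ltn ts -> all (fun t => t < size w) ts -> subseq (map (nth x0 w) ts) w.
Proof.
move=> ts_sorted ts_lt; rewrite -{2}(mkseq_nth x0 w) /mkseq.
apply: map_subseq.
suff -> : ts = [seq t <- iota 0 (size w) | t \in ts] by apply: filter_subseq.
apply: (irr_sorted_eq ltn_trans ltnn) => //.
  by apply: sorted_filter (iota_ltn_sorted _ _); apply: ltn_trans.
move=> t; rewrite mem_filter mem_iota add0n /=.
by case tts: (t \in ts) => //=; rewrite (allP ts_lt).
Qed.

Lemma containsP (w s : seq nat) :
  contains w s <->
  exists t : nat -> nat,
    [/\ forall i j, i < j < size s -> t i < t j,
        forall i, i < size s -> t i < size w
      & forall i j, i < size s -> j < size s ->
          (nth 0 w (t i) < nth 0 w (t j)) = (nth 0 s i < nth 0 s j)].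
Proof.
split=> [[u uw [su iso]] | [t [incr lt_t iso]]].
  have [m sm uE] := subseqP uw.
  pose ts := mask m (iota 0 (size w)).
  have uT : u = map (nth 0 w) ts by rewrite map_mask -/(mkseq _ _) mkseq_nth.
  have st : size ts = size s by rewrite -su uT size_map.
  have so : sorted ltn ts by apply: sorted_mask (iota_ltn_sorted _ _); apply: ltn_trans.
  exists (nth 0 ts); split.
  - move=> i j /andP[ij js]; apply: (sorted_ltn_nth ltn_trans) => //;
      rewrite inE st //; exact: ltn_trans js.
  - move=> i; rewrite -st => /(mem_nth 0) /mem_mask.
    by rewrite mem_iota.
  - move=> i j si sj; rewrite -iso ?su // uT !(nth_map 0) ?st //.
exists (map (nth 0 w) (mkseq t (size s))).
  apply: subseq_nth.
    apply/(sortedP 0) => i; rewrite size_mkseq => iS.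
    by rewrite !nth_mkseq ?(ltnW iS) //; apply: incr; rewrite ltnSn.
  by apply/allP => x /mapP[i]; rewrite mem_iota => /andP[_ si] ->; apply: lt_t.
split; first by rewrite size_map size_mkseq.
move=> i j; rewrite size_map size_mkseq => si sj.
by rewrite -map_comp !(nth_map 0) ?size_iota // !nth_iota //= iso.
Qed.

Lemma contains321 (w : seq nat) (a b c : nat) :
  a < b -> b < c -> c < size w ->
  nth 0 w b < nth 0 w a -> nth 0 w c < nth 0 w b -> contains w [:: 3; 2; 1].
Proof.
move=> ab bc cw ba cb; apply/containsP.
exists (fun i => nth 0 [:: a; b; c] i); split.
- by case=> [|[|[|i]]] [|[|[|j]]] //=; lia.
- by case=> [|[|[|i]]] //= _; lia.
- by case=> [|[|[|i]]] [|[|[|j]]] //= _ _; lia.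
Qed.

(** * Avoidance and universality *)

Lemma rho_avoids_321 n : 0 < n -> avoids (rho n) [:: 3; 2; 1].
Proof.
move=> n0 /containsP[t [incr lt_t iso]].
rewrite size_rho //= in lt_t.
have [c0 [j0 [cn0 jn0 E0]]] := rho_pos_surj n (t 0) (lt_t 0 isT).
have [c1 [j1 [cn1 jn1 E1]]] := rho_pos_surj n (t 1) (lt_t 1 isT).
have [c2 [j2 [cn2 jn2 E2]]] := rho_pos_surj n (t 2) (lt_t 2 isT).
have p01 := incr 0 1 isT; have p12 := incr 1 2 isT.
have v10 := iso 1 0 isT isT; have v21 := iso 2 1 isT isT.
rewrite -E0 -E1 -E2 !nth_rho //= in p01 p12 v10 v21.
have /andP[_ e1] := inversion_parity _ _ _ _ _ cn0 cn1 jn0 jn1 p01 v10.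
have /andP[o1 _] := inversion_parity _ _ _ _ _ cn1 cn2 jn1 jn2 p12 v21.
by rewrite o1 in e1.
Qed.

Lemma rho_contains n s : 0 < n -> is_perm_word n s ->
  avoids s [:: 3; 2; 1] -> contains (rho n) s.
Proof.
move=> n0 ps av.
have ss : size s = n by rewrite (perm_size ps) size_iota.
have us : uniq s by rewrite (perm_uniq ps) iota_uniq.
pose v (i : 'I_n) := nth 0 s i.
have vI : injective v.
  by move=> x y /eqP; rewrite nth_uniq ?ss // => /eqP/val_inj.
have av3 (x y z : 'I_n) : x < y -> y < z -> v y < v x -> v z < v y -> False.
  move=> xy yz yx zy; apply: av.
  by apply: (contains321 s x y z) => //; rewrite ss.
have [c [f [cn _ _ mon inv]]] :=
  staircase _ (@nat_of_ord n) v setT (@ord_inj n) vI av3.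
have {}cn (x : 'I_n) : c x < n by rewrite -[X in _ < X](card_ord n) -cardsT cn ?inE.
(* The values of [f] may be large; their ranks preserve strict and weak order and fit into the [n]
   slots of a cell. *)
pose j (x : 'I_n) := #|[set z | f z < f x]|.
have jlt (x y : 'I_n) : f x < f y -> j x < j y.
  move=> xy; apply/proper_card/properP; split.
    by apply/subsetP => z; rewrite !inE => /ltn_trans->.
  by exists x; rewrite !inE // ltnn.
have jle (x y : 'I_n) : f x <= f y -> j x <= j y.
  move=> xy; apply/subset_leq_card/subsetP => z; rewrite !inE => zx.
  exact: leq_trans xy.
have jn (x : 'I_n) : j x < n.
  rewrite -[X in _ < X](card_ord n) -cardsT; apply/proper_card/properP.
  by split; [apply: subsetT | exists x; rewrite !inE // ltnn].
have {}mon (x y : 'I_n) : x < y -> v x < v y ->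
    c x <= c y /\ (c y <= (c x).+1 -> j x < j y).
  move=> xy vxy; have [] := mon x y (in_setT _) (in_setT _) xy vxy.
  by move=> ? H; split=> // /H /jlt.
have {}inv (x y : 'I_n) : x < y -> v y < v x -> [/\ odd (c x), ~~ odd (c y)
    & (c x = (c y).+1 /\ j x <= j y) \/ (c y = (c x).+1 /\ j y <= j x)].
  move=> xy vyx; have [? ? H] := inv x y (in_setT _) (in_setT _) xy vyx.
  by split=> //; case: H => -[-> /jle]; [left|right].
have pos_mono (x y : 'I_n) : x < y -> pos n (c x) (j x) < pos n (c y) (j y).
  move=> xy.
  have: v x != v y by apply: contraTneq xy => /vI ->; rewrite ltnn.
  rewrite neq_ltn => /orP[vxy|vyx].
    by have [] := mon x y xy vxy; apply: pos_lt_sw.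
  have [ox oy H] := inv x y xy vyx; apply: pos_lt_inv => //.
  by case: H => [|[-> _]]; [left | right].
have letter_mono (x y : 'I_n) : v x < v y ->
    letter n (c x) (j x) < letter n (c y) (j y).
  move=> vxy.
  have: x != y :> nat by apply: contraTneq vxy => /ord_inj ->; rewrite ltnn.
  rewrite neq_ltn => /orP[xy|yx].
    by have [] := mon x y xy vxy; apply: letter_lt_sw.
  have [oy ox H] := inv y x yx vxy; apply: letter_lt_inv => //.
  by case: H => [[-> _]|]; [right | left].
(* A total position map is required; the default for [i >= n] is arbitrary. *)
pose at_ i := insubd (Ordinal n0) i.
have atK i : i < n -> at_ i = i :> nat by rewrite val_insubd => ->.
apply/containsP; exists (fun i => pos n (c (at_ i)) (j (at_ i))).
rewrite ss; split.
- move=> i k /andP[ik kn]; apply: pos_mono.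
  by rewrite !atK // (ltn_trans ik).
- by move=> i _; rewrite size_rho // pos_lt_size.
- move=> i k iN kN; rewrite !nth_rho //.
  have -> : nth 0 s i = v (at_ i) by rewrite /v atK.
  have -> : nth 0 s k = v (at_ k) by rewrite /v atK.
  move: (at_ i) (at_ k) => x y.
  (* The converse follows since [v] is injective and totally ordered. *)
  apply/idP/idP; last exact: letter_mono.
  apply: contraTT; rewrite -!leqNgt leq_eqVlt => /orP[/eqP/vI->//|].
  by move/letter_mono/ltnW.
Qed.

Theorem theorem3p1 (n : nat) (hn : 1 <= n) :
  is_perm_word (n ^ 2) (rho n) /\ proper_universal [:: 3; 2; 1] n (rho n).
Proof.
have pr := rho_is_perm n hn; split=> //; split; last exact: rho_avoids_321.
split; first by rewrite size_rho.
by move=> s ps [_ av]; apply: rho_contains.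
Qed.
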